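(* ${\sf TB}^-_{\sf ID}\not\blacktriangleright_{\sf EA}{\sf UTB}^-_{\sf ID}$; that is, there is no identity-preserving unrelativized interpretation of ${\sf EA}+{\sf UTB}^-_{\sf ID}$ in ${\sf EA}+{\sf TB}^-_{\sf ID}$ that translates the arithmetical vocabulary identically.
   Context: ${\sf EA}=\mathrm I\Delta_0+{\sf exp}$ in the arithmetical language; ${\sf ID}$ is the identity interpretation of the numbers. ${\sf T}$ is a fresh unary predicate (and is not covered by the induction axioms of ${\sf EA}$). ${\sf TB}^-_{\sf ID}$ is the set of $A\leftrightarrow{\sf T}(\underline{\ulcorner A\urcorner})$ for arithmetical sentences $A$; ${\sf UTB}^-_{\sf ID}$ is the set of $\forall\vec x\,({\sf T}\ulcorner A(\dot{\vec x})\urcorner\leftrightarrow A(\vec x))$ for arithmetical formulas $A$, where $\ulcorner A(\dot{\vec x})\urcorner$ is the code of the result of substituting efficient numerals for $\vec x$. *)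

(* Defs.v *)
From mathcomp Require Import all_boot.

Set Implicit Arguments.
Unset Strict Implicit.
Unset Printing Implicit Defensive.

(* Variables are de Bruijn indices. *)
Inductive tm : Type :=
  | Var of nat
  | Zero
  | Succ of tm
  | Add of tm & tm
  | Mul of tm & tm.

Inductive fm : Type :=
  | Eq of tm & tm
  | Le of tm & tm
  | Tr of tm
  | Bot
  | Imp of fm & fm
  | All of fm.

Definition Not A := Imp A Bot.
Definition And A B := Not (Imp A (Not B)).
Definition Iff A B := And (Imp A B) (Imp B A).
Definition Ex A := Not (All (Not A)).
Definition Lt s t := Le (Succ s) t.

Definition alls (n : nat) (A : fm) : fm := iter n All A.
Definition exs (n : nat) (A : fm) : fm := iter n Ex A.
Definition ands (s : seq fm) : fm := foldr And (Eq Zero Zero) s.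

Fixpoint subst_tm (f : nat -> tm) (t : tm) : tm :=
  match t with
  | Var n => f n
  | Zero => Zero
  | Succ s => Succ (subst_tm f s)
  | Add s u => Add (subst_tm f s) (subst_tm f u)
  | Mul s u => Mul (subst_tm f s) (subst_tm f u)
  end.

Definition shift (t : tm) : tm := subst_tm (fun n => Var n.+1) t.

Definition scons (t : tm) (f : nat -> tm) (n : nat) : tm :=
  if n is m.+1 then f m else t.

Definition up (f : nat -> tm) : nat -> tm :=
  scons (Var 0) (fun n => shift (f n)).

Fixpoint subst (f : nat -> tm) (A : fm) : fm :=
  match A with
  | Eq s t => Eq (subst_tm f s) (subst_tm f t)
  | Le s t => Le (subst_tm f s) (subst_tm f t)
  | Tr t => Tr (subst_tm f t)
  | Bot => Bot
  | Imp B C => Imp (subst f B) (subst f C)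
  | All B => All (subst (up f) B)
  end.

Definition shift_fm (A : fm) : fm := subst (fun n => Var n.+1) A.

Definition inst (A : fm) (t : tm) : fm := subst (scons t Var) A.

(* All free variables have index below [n]. *)
Fixpoint bounded_tm (n : nat) (t : tm) : bool :=
  match t with
  | Var m => m < n
  | Zero => true
  | Succ s => bounded_tm n s
  | Add s u => bounded_tm n s && bounded_tm n u
  | Mul s u => bounded_tm n s && bounded_tm n u
  end.

Fixpoint bounded (n : nat) (A : fm) : bool :=
  match A with
  | Eq s t => bounded_tm n s && bounded_tm n t
  | Le s t => bounded_tm n s && bounded_tm n t
  | Tr t => bounded_tm n t
  | Bot => true
  | Imp B C => bounded n B && bounded n C
  | All B => bounded n.+1 B
  end.

Definition sentence (A : fm) : bool := bounded 0 A.

Fixpoint arithmetical (A : fm) : bool :=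
  match A with
  | Tr _ => false
  | Imp B C => arithmetical B && arithmetical C
  | All B => arithmetical B
  | _ => true
  end.

(* Natural deduction for classical logic with equality; [G] is the set of
   assumptions. *)
Inductive nd : (fm -> Prop) -> fm -> Prop :=
  | nd_ctx (G : fm -> Prop) A : G A -> nd G A
  | nd_impI (G : fm -> Prop) A B :
      nd (fun C => C = A \/ G C) B -> nd G (Imp A B)
  | nd_impE (G : fm -> Prop) A B : nd G (Imp A B) -> nd G A -> nd G B
  | nd_raa (G : fm -> Prop) A : nd (fun C => C = Not A \/ G C) Bot -> nd G A
  | nd_allI (G : fm -> Prop) A :
      nd (fun C => exists2 B, G B & C = shift_fm B) A -> nd G (All A)
  | nd_allE (G : fm -> Prop) A t : nd G (All A) -> nd G (inst A t)
  | nd_refl (G : fm -> Prop) t : nd G (Eq t t)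
  | nd_eqE (G : fm -> Prop) A s t :
      nd G (Eq s t) -> nd G (inst A s) -> nd G (inst A t).

Definition theory := fm -> Prop.
Definition provable (X : theory) (A : fm) : Prop := nd X A.
Definition join (X Y : theory) : theory := fun A => X A \/ Y A.

(* Goedel's beta function: [r] is the remainder of [a] modulo [(i + 1) b + 1]. *)
Definition Beta (a b i r : tm) : fm :=
  And (Le r (Mul (Succ i) b))
      (Ex (Eq (shift a)
              (Add (Mul (Var 0) (Succ (Mul (Succ (shift i)) (shift b))))
                   (shift r)))).

(* [2 ^ x = y]: some sequence coded by [a = Var 1], [b = Var 0] starts with 1,
   is doubled at each of its first [x] steps, and has [y] at place [x].  This
   graph is Sigma_1; over [I Delta_0] the totality statement it gives is
   equivalent to the one with the usual Delta_0 graph. *)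
Definition Exp (x y : tm) : fm :=
  let x2 := shift (shift x) in
  let y2 := shift (shift y) in
  exs 2 (ands
    [:: Beta (Var 1) (Var 0) Zero (Succ Zero);
        All (Imp (Lt (Var 0) (shift x2))
          (Ex (And (Beta (Var 3) (Var 2) (Var 1) (Var 0))
                   (Beta (Var 3) (Var 2) (Succ (Var 1))
                         (Add (Var 0) (Var 0))))));
        Beta (Var 1) (Var 0) x2 y2]).

Inductive robinson : theory :=
  | Q_succ0 : robinson (All (Not (Eq (Succ (Var 0)) Zero)))
  | Q_succI : robinson (alls 2 (Imp (Eq (Succ (Var 1)) (Succ (Var 0)))
                                    (Eq (Var 1) (Var 0))))
  | Q_pred : robinson (All (Imp (Not (Eq (Var 0) Zero))
                                (Ex (Eq (Var 1) (Succ (Var 0))))))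
  | Q_add0 : robinson (All (Eq (Add (Var 0) Zero) (Var 0)))
  | Q_addS : robinson (alls 2 (Eq (Add (Var 1) (Succ (Var 0)))
                                  (Succ (Add (Var 1) (Var 0)))))
  | Q_mul0 : robinson (All (Eq (Mul (Var 0) Zero) Zero))
  | Q_mulS : robinson (alls 2 (Eq (Mul (Var 1) (Succ (Var 0)))
                                  (Add (Mul (Var 1) (Var 0)) (Var 1))))
  | Q_le : robinson (alls 2 (Iff (Le (Var 1) (Var 0))
                                 (Ex (Eq (Add (Var 0) (Var 2)) (Var 1))))).

(* No clause for [Tr]: the induction axioms are purely arithmetical. *)
Inductive delta0 : fm -> Prop :=
  | delta0_eq s t : delta0 (Eq s t)
  | delta0_le s t : delta0 (Le s t)
  | delta0_bot : delta0 Bot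
  | delta0_imp A B : delta0 A -> delta0 B -> delta0 (Imp A B)
  | delta0_all t A :
      delta0 A -> delta0 (All (Imp (Le (Var 0) (shift t)) A)).

(* Induction on [Var 0]; the other variables of [A] are parameters. *)
Definition induction (A : fm) : fm :=
  Imp (inst A Zero)
    (Imp (All (Imp A (subst (scons (Succ (Var 0)) (fun n => Var n.+1)) A)))
         (All A)).

Inductive EA : theory :=
  | EA_robinson A : robinson A -> EA A
  | EA_induction n A :
      delta0 A -> bounded n.+1 A -> EA (alls n (induction A))
  | EA_exp : EA (All (Ex (Exp (Var 1) (Var 0)))).

Definition two : tm := Succ (Succ Zero).

Fixpoint num_rec (fuel n : nat) : tm :=
  match fuel with
  | 0 => Zero
  | f.+1 => if n == 0 then Zero
            else let d := Mul (num_rec f n./2) two in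
                 if odd n then Succ d else d
  end.

(* Efficient (binary) numerals: [0], [num n * 2] and [S (num n * 2)].
   The recursion needs at most [n] steps. *)
Definition num (n : nat) : tm := num_rec n n.

Inductive letter : Type :=
  | L_zero | L_succ | L_add | L_mul | L_eq | L_le | L_tr | L_bot | L_imp
  | L_all | L_var | L_bar.

Definition digit (l : letter) : nat :=
  match l with
  | L_zero => 1 | L_succ => 2 | L_add => 3 | L_mul => 4
  | L_eq => 5 | L_le => 6 | L_tr => 7 | L_bot => 8 | L_imp => 9
  | L_all => 10 | L_var => 11 | L_bar => 12
  end.

(* Expressions are written in reverse Polish notation, the variable of index
   [n] being the letter [L_var] followed by [n] bars; [code] is used for
   sentences. *)
Definition var_word (n : nat) : seq letter := L_var :: nseq n L_bar.

Fixpoint tm_word (t : tm) : seq letter :=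
  match t with
  | Var n => var_word n
  | Zero => [:: L_zero]
  | Succ s => tm_word s ++ [:: L_succ]
  | Add s u => tm_word s ++ tm_word u ++ [:: L_add]
  | Mul s u => tm_word s ++ tm_word u ++ [:: L_mul]
  end.

Fixpoint fm_word (A : fm) : seq letter :=
  match A with
  | Eq s t => tm_word s ++ tm_word t ++ [:: L_eq]
  | Le s t => tm_word s ++ tm_word t ++ [:: L_le]
  | Tr t => tm_word t ++ [:: L_tr]
  | Bot => [:: L_bot]
  | Imp B C => fm_word B ++ fm_word C ++ [:: L_imp]
  | All B => fm_word B ++ [:: L_all]
  end.

(* A word is coded by the number it denotes in base 13.  The digit 0 is not
   used and 13 is prime, which makes the length function simple: see [Len]. *)
Definition word_code (w : seq letter) : nat :=
  foldl (fun c l => c * 13 + digit l) 0 w.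

Definition code (A : fm) : nat := word_code (fm_word A).

Definition snoc_tm (c : tm) (l : letter) : tm :=
  Add (Mul c (num 13)) (num (digit l)).

(* [y] is the code of the word of [num x].  The sequence coded by [a = Var 1],
   [b = Var 0] satisfies the recursion equations of [num], written for codes:
   its value at [2 i + 1], and at [2 i] when [i != 0], is obtained from its
   value [u] at [i] by appending letters, for all [i <= x]. *)
Definition Num (x y : tm) : fm :=
  let x2 := shift (shift x) in
  let y2 := shift (shift y) in
  let dbl u := foldl snoc_tm u (tm_word two ++ [:: L_mul]) in
  exs 2 (ands
    [:: Beta (Var 1) (Var 0) Zero (num (word_code (tm_word Zero)));
        All (Imp (Le (Var 0) (shift x2))
          (Ex (ands
            [:: Beta (Var 3) (Var 2) (Var 1) (Var 0);
                Imp (Not (Eq (Var 1) Zero))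
                  (Beta (Var 3) (Var 2) (Add (Var 1) (Var 1)) (dbl (Var 0)));
                Beta (Var 3) (Var 2) (Succ (Add (Var 1) (Var 1)))
                  (snoc_tm (dbl (Var 0)) L_succ)])));
        Beta (Var 1) (Var 0) x2 y2]).

(* [p] is a power of 13: every divisor of [p] other than 1 is a
   multiple of 13. *)
Definition Pow (p : tm) : fm :=
  alls 2 (Imp (Eq (Mul (Var 1) (Var 0)) (shift (shift p)))
    (Imp (Not (Eq (Var 1) (Succ Zero)))
      (Ex (Eq (Var 2) (Mul (num 13) (Var 0)))))).

(* [p] is 13 to the length of the word coded by [y], for nonempty words. *)
Definition Len (y p : tm) : fm :=
  ands [:: Pow p; Lt y p; Le p (Mul (num 13) y)].

(* Words with holes: [inr i] stands for the numeral of the value of the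
   free variable [i]. *)
Definition token : Type := (letter + nat)%type.
Definition letters (w : seq letter) : seq token := map inl w.

(* [k] is the number of quantifiers above the current position: variables
   with index below [k] are bound, the variable [k + i] is the free variable
   [i] of the whole formula. *)
Fixpoint tm_template (k : nat) (t : tm) : seq token :=
  match t with
  | Var n => if n < k then letters (var_word n) else [:: inr (n - k)]
  | Zero => letters [:: L_zero]
  | Succ s => tm_template k s ++ letters [:: L_succ]
  | Add s u => tm_template k s ++ tm_template k u ++ letters [:: L_add]
  | Mul s u => tm_template k s ++ tm_template k u ++ letters [:: L_mul]
  end.

Fixpoint fm_template (k : nat) (A : fm) : seq token :=
  match A with
  | Eq s t => tm_template k s ++ tm_template k t ++ letters [:: L_eq]
  | Le s t => tm_template k s ++ tm_template k t ++ letters [:: L_le]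
  | Tr t => tm_template k t ++ letters [:: L_tr]
  | Bot => letters [:: L_bot]
  | Imp B C => fm_template k B ++ fm_template k C ++ letters [:: L_imp]
  | All B => fm_template k.+1 B ++ letters [:: L_all]
  end.

(* The code of a word with holes, where [y i] is the code of the word put in
   hole [i] and [p i] is 13 to the length of that word. *)
Definition template_tm (y p : nat -> tm) (w : seq token) : tm :=
  foldl (fun c k => match k with
                    | inl l => snoc_tm c l
                    | inr i => Add (Mul c (p i)) (y i)
                    end) Zero w.

(* The formula usually written [T] of the code of [A(x_0-dot, ..., x_(n-1)-dot)],
   for [A] with free variables [x_0, ..., x_(n-1)]: the [y_i] are the codes of
   the numerals of the [x_i].  Under the [2 n] existential quantifiers, [y_i]
   is [Var i], [p_i] is [Var (n + i)] and [x_i] is [Var (2 n + i)]. *)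
Definition Tr_dot (n : nat) (A : fm) : fm :=
  let y i := Var i in
  let p i := Var (n + i) in
  let x i := Var (n.*2 + i) in
  exs n.*2 (And (ands [seq And (Num (x i) (y i)) (Len (y i) (p i))
                         | i <- iota 0 n])
                (Tr (template_tm y p (fm_template 0 A)))).

Inductive TB : theory :=
  | TB_ax A : arithmetical A -> sentence A -> TB (Iff A (Tr (num (code A)))).

Inductive UTB : theory :=
  | UTB_ax n A : arithmetical A -> bounded n A ->
      UTB (alls n (Iff (Tr_dot n A) A)).

(* A translation that is unrelativized, preserves identity and is the identity
   on the arithmetical vocabulary is given by a formula [tau] with [Var 0] as
   its only free variable, the translation of [Tr (Var 0)]. *)
Fixpoint translate (tau : fm) (A : fm) : fm :=
  match A with
  | Tr t => inst tau t
  | Imp B C => Imp (translate tau B) (translate tau C)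
  | All B => All (translate tau B)
  | _ => A
  end.

Definition interpretation (tau : fm) (U V : theory) : Prop :=
  bounded 1 tau /\
  forall A, sentence A -> provable V A -> provable U (translate tau A).

(* The theories over [EA] axiomatized by [X] and [Y]: the first one interprets
   the second one, identically on arithmetic. *)
Definition id_interprets (X Y : theory) : Prop :=
  exists tau, interpretation tau (join EA X) (join EA Y).

(* Main.v *)
(* Everything happens in the standard model.  A proof uses only finitely many
   axioms of [TB], and these hold as soon as [Tr] is read as a finite set, hence
   as an arithmetical predicate [t |-> beta a b t = 1] with parameters [a], [b].
   Under that reading the interpreting formula [tau] becomes an arithmetical
   formula tau'(t, a, b).  Uniform disquotation for it is refuted by a liar
   formula with parameters, L(a, b, ...) <-> ~ tau'(code of L(a., b., ...), a, b),
   which, unlike [a] and [b], does not depend on the proof.  The liar formula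
   repeats the conjuncts [Num] and [Len] of [Tr_dot] literally, so what these
   formulas mean is irrelevant. *)
From Stdlib Require Import Classical.
From Stdlib Require List.
From mathcomp Require Import all_boot zify.
Require Import Defs.

Set Implicit Arguments.
Unset Strict Implicit.
Unset Printing Implicit Defensive.

(** * Satisfaction in the standard model, for any reading of [Tr] *)

Definition push (n : nat) (e : nat -> nat) (k : nat) : nat :=
  if k is j.+1 then e j else n.

Fixpoint eval (e : nat -> nat) (t : tm) : nat :=
  match t with
  | Var n => e n
  | Zero => 0
  | Succ s => (eval e s).+1
  | Add s u => eval e s + eval e u
  | Mul s u => eval e s * eval e u
  end.

Fixpoint sat (T : nat -> Prop) (e : nat -> nat) (A : fm) : Prop :=
  match A with
  | Eq s t => eval e s = eval e t
  | Le s t => eval e s <= eval e t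
  | Tr t => T (eval e t)
  | Bot => False
  | Imp B C => sat T e B -> sat T e C
  | All B => forall n, sat T (push n e) B
  end.

Lemma eval_subst e e' f t :
  (forall i, e' i = eval e (f i)) -> eval e (subst_tm f t) = eval e' t.
Proof.
by move=> ef; elim: t => //= [s ->|s -> u ->|s -> u ->].
Qed.

Lemma eval_shift n e t : eval (push n e) (shift t) = eval e t.
Proof. exact: eval_subst. Qed.

Lemma sat_subst T A e e' f :
  (forall i, e' i = eval e (f i)) -> sat T e (subst f A) <-> sat T e' A.
Proof.
elim: A e e' f => [s t|s t|t||B IHB C IHC|B IHB] e e' f ef /=;
  rewrite ?(eval_subst _ ef) //.
- by rewrite (IHB e e') // (IHC e e').
- have efn n i : push n e' i = eval (push n e) (up f i).
    by case: i => //= i; rewrite eval_shift.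
  by split=> H n; apply/(IHB _ _ _ (efn n)).
Qed.

Lemma sat_inst T e A t : sat T e (inst A t) <-> sat T (push (eval e t) e) A.
Proof. by apply: sat_subst => -[|i]. Qed.

Lemma sat_shift T n e A : sat T (push n e) (shift_fm A) <-> sat T e A.
Proof. exact: sat_subst. Qed.

Lemma eval_bounded n e e' t :
  bounded_tm n t -> (forall i, i < n -> e i = e' i) -> eval e t = eval e' t.
Proof.
move=> bt ee; elim: t bt => //= [s IH /IH -> //|s IHs u IHu|s IHs u IHu].
- by case/andP=> /IHs -> /IHu ->.
- by case/andP=> /IHs -> /IHu ->.
Qed.

Lemma sat_bounded T A n e e' :
  bounded n A -> (forall i, i < n -> e i = e' i) -> sat T e A <-> sat T e' A.
Proof.
elim: A n e e' => [s t|s t|t||B IHB C IHC|B IHB] n e e' /= bA ee //.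
- by case/andP: bA => bs bt; rewrite (eval_bounded bs ee) (eval_bounded bt ee).
- by case/andP: bA => bs bt; rewrite (eval_bounded bs ee) (eval_bounded bt ee).
- by rewrite (eval_bounded bA ee).
- by case/andP: bA => bB bC; rewrite (IHB _ _ _ bB ee) (IHC _ _ _ bC ee).
- have een k i : i < n.+1 -> push k e i = push k e' i by case: i => //= i /ee.
  by split=> H k; apply/(IHB _ _ _ bA (een k)).
Qed.

Lemma sat_arithmetical T T' e A :
  arithmetical A -> sat T e A <-> sat T' e A.
Proof.
elim: A e => [s t|s t|t||B IHB C IHC|B IHB] e //=.
- by case/andP=> aB aC; rewrite (IHB _ aB) (IHC _ aC).
- by move=> aB; split=> H n; apply/(IHB _ aB).
Qed.

Lemma sat_and T e A B : sat T e (And A B) <-> sat T e A /\ sat T e B.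
Proof.
by have := classic (sat T e A); have := classic (sat T e B); rewrite /=; tauto.
Qed.

Lemma sat_iff T e A B :
  sat T e (Iff A B) <-> (sat T e A <-> sat T e B).
Proof. by rewrite sat_and. Qed.

Lemma sat_ex T e A : sat T e (Ex A) <-> exists n, sat T (push n e) A.
Proof.
split=> [/= H|[n An] /= /(_ n)]; last exact.
by apply: NNPP => nA; apply: H => n An; apply: nA; exists n.
Qed.

Lemma sat_imp T e A B : sat T e (Imp A B) <-> (sat T e A -> sat T e B).
Proof. by []. Qed.

Lemma sat_all T e A : sat T e (All A) <-> forall n, sat T (push n e) A.
Proof. by []. Qed.

Lemma sat_not T e A : sat T e (Not A) <-> ~ sat T e A.
Proof. by []. Qed.

Lemma sat_alls T n e A : (forall e', sat T e' A) -> sat T e (alls n A).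
Proof. by move=> H; elim: n e => [|n IHn] e //= k; apply: IHn. Qed.

(* Soundness and compactness at once: the finiteness of [L] is what makes it
   possible to satisfy the axioms of [TB] in [L] with a coded [Tr]. *)
Lemma nd_sound G A : nd G A ->
  exists2 L, List.Forall G L &
    forall T e, List.Forall (sat T e) L -> sat T e A.
Proof.
(* For [nd_impI] and [nd_raa]: [L] may contain the discharged formula any number of times, and it is
   filtered out. *)
have discharge (H : fm -> Prop) B L :
    List.Forall (fun C => C = B \/ H C) L ->
    exists2 L', List.Forall H L' & forall T e,
      sat T e B -> List.Forall (sat T e) L' -> List.Forall (sat T e) L.
  elim=> [|C L1 HC _ [L' HL' IH]]; first by exists nil.
  case: HC => [->|HC].
    by exists L' => // T e HB /(IH _ _ HB) ?; constructor.
  exists (C :: L'); first by constructor.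
  move=> T e HB /List.Forall_cons_iff[HCe /(IH _ _ HB)].
  by constructor.
(* For [nd_allI]: shifted premises ignore the value of the quantified variable. *)
have unshift (H : fm -> Prop) L :
    List.Forall (fun C => exists2 B, H B & C = shift_fm B) L ->
    exists2 L', List.Forall H L' & forall T e,
      List.Forall (sat T e) L' -> forall n, List.Forall (sat T (push n e)) L.
  elim=> [|C L1 [B HB ->] _ [L' HL' IH]]; first by exists nil.
  exists (B :: L'); first by constructor.
  move=> T e /List.Forall_cons_iff[HBe /IH HL n].
  by constructor=> //; apply/sat_shift.
elim=> {G A}.
- move=> G A GA; exists [:: A]; first by constructor.
  by move=> T e /List.Forall_cons_iff[].
- move=> G A B _ [L /discharge[L' HL' HLL'] HL]; exists L' => // T e He HA.
  exact/HL/HLL'.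
- move=> G A B _ [L1 HL1 H1] _ [L2 HL2 H2]; exists (L1 ++ L2).
    exact/List.Forall_app.
  by move=> T e /List.Forall_app[/H1 HAB /H2 /HAB].
- move=> G A _ [L /discharge[L' HL' HLL'] HL]; exists L' => // T e He.
  by apply: NNPP => nA; apply: (HL T e); apply: HLL'.
- move=> G A _ [L /unshift[L' HL' HLL'] HL]; exists L' => // T e He n.
  exact/HL/HLL'.
- move=> G A t _ [L HL H]; exists L => // T e /H HA.
  exact/sat_inst.
- by move=> G t; exists nil.
- move=> G A s t _ [L1 HL1 H1] _ [L2 HL2 H2]; exists (L1 ++ L2).
    exact/List.Forall_app.
  move=> T e /List.Forall_app[/H1 /= st /H2 /sat_inst HA].
  by apply/sat_inst; rewrite -st.
Qed.

(** * Goedel's beta function *)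

Definition beta (a b i r : nat) : Prop :=
  r <= i.+1 * b /\ exists q, a = q * (i.+1 * b).+1 + r.

Lemma sat_Beta T e a b i r :
  sat T e (Beta a b i r) <-> beta (eval e a) (eval e b) (eval e i) (eval e r).
Proof.
rewrite /Beta sat_and sat_ex /= /beta.
by split=> -[H [q Hq]]; split=> //; exists q; move: Hq; rewrite !eval_shift.
Qed.

Lemma beta_inj a b i r r' : beta a b i r -> beta a b i r' -> r = r'.
Proof.
by case=> rb [q ->] [r'b [q' /(congr1 (modn^~ (i.+1 * b).+1))]];
  rewrite !modnMDl !modn_small.
Qed.

(** A common divisor is coprime to [b] and divides [(j - i) * b], hence divides [j - i], hence the
    factorial and [b] itself; so it is 1. *)
Lemma beta_coprime n b i j :
  n`! %| b -> i < j < n -> coprime (i.+1 * b).+1 (j.+1 * b).+1.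
Proof.
move=> nb /andP[ij jn]; rewrite /coprime; set d := gcdn _ _.
have di : d %| (i.+1 * b).+1 by apply: dvdn_gcdl.
have dj : d %| (j.+1 * b).+1 by apply: dvdn_gcdr.
have cdb : coprime d b.
  apply: (coprime_dvdl di); rewrite coprime_sym /coprime -addn1 gcdnMDl.
  by rewrite gcdn1.
have dji : d %| (j - i) * b.
  have -> : (j - i) * b = (j.+1 * b).+1 - (i.+1 * b).+1.
    by rewrite subSS -mulnBl subSS.
  exact: dvdn_sub.
have {}dji : d %| b.
  move: dji; rewrite Gauss_dvdl // => /dvdn_trans; apply.
  by apply: dvdn_trans nb; apply: dvdn_fact; lia.
by rewrite -(eqP cdb); apply/eqP/esym/gcdn_idPl.
Qed.

Lemma beta_exists (f : nat -> nat) n :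
  exists a b, forall i, i < n -> beta a b i (f i).
Proof.
(* The factorial makes the moduli coprime; the other factor makes each [f i] smaller than its
   modulus. *)
pose b := n`! * (\max_(i < n) f i).+1.
pose m i := (i.+1 * b).+1.
have fb i : i < n -> f i <= i.+1 * b.
  move=> ltin; rewrite /b mulnA.
  apply: leq_trans (leq_pmull _ _); last by rewrite muln_gt0 fact_gt0.
  exact/leqW/(@leq_bigmax 'I_n (fun k => f k) (Ordinal ltin)).
suff [a Ha] : exists a, forall i, i < n -> a = f i %[mod m i].
  exists a, b => i ltin; split; first exact: fb.
  exists (a %/ m i); rewrite {1}(divn_eq a (m i)) Ha // modn_small //.
  by rewrite ltnS fb.
(* The moduli depend on [n], so [n] stays fixed while the number [k] of solved congruences grows. *)
elim: {-2}n (leqnn n) => [|k IHk] ltkn; first by exists 0.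
have [a Ha] := IHk (ltnW ltkn).
exists (chinese (\prod_(i < k) m i) (m k) a (f k)) => i.
have co : coprime (\prod_(i < k) m i) (m k).
  apply: (big_ind (fun x => coprime x (m k))) => [|x y cx cy|j _].
  - exact: coprime1n.
  - by rewrite coprimeMl cx.
  apply: (@beta_coprime n); first exact: dvdn_mulr.
  by rewrite ltn_ord.
rewrite ltnS leq_eqVlt => /orP[/eqP->|ltik]; first exact: chinese_modr.
rewrite -(Ha _ ltik) -[m i]/(m (Ordinal ltik)).
set p := \prod_(i < k) _ in co *.
have mp : m (Ordinal ltik) %| p by rewrite /p (bigD1 (Ordinal ltik)) ?dvdn_mulr.
by rewrite -(modn_dvdm _ mp) chinese_modl // modn_dvdm.
Qed.

(** Excluded middle decides the finitely many instances one at a time, and the resulting bits are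
    coded as a sequence. *)
Lemma beta_pred (P : nat -> Prop) n :
  exists a b, forall i, i < n -> (beta a b i 1 <-> P i).
Proof.
have [s Hs] : exists s : nat -> bool, forall i, i < n -> (s i <-> P i).
  elim: n => [|n [s Hs]]; first by exists xpred0.
  have [b Hb] : exists b : bool, b <-> P n.
    by have [Pn|nPn] := classic (P n); [exists true | exists false].
  exists (fun i => if i == n then b else s i) => i.
  by rewrite ltnS leq_eqVlt; case: eqP => [-> //|_] /Hs.
have [a [b Hab]] := beta_exists s n.
exists a, b => i ltin; rewrite -(Hs _ ltin); have := Hab _ ltin.
by split=> [/(beta_inj H)|si]; [case: (s i) | move: H; rewrite si].
Qed.

(** [T] is arbitrary, which leaves the reading of [Tr] free to be fitted to axioms of [TB]. *)
Lemma sat_EA T e A : EA A -> sat T e A.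
Proof.
case=> [B|n B _ _|].
- case.
  + by [].
  + by move=> /= n m [].
  + by move=> /= [|n] // _ /(_ n); apply.
  + by move=> n /=; rewrite addn0.
  + by move=> /= n m; rewrite addnS.
  + by move=> n /=; rewrite muln0.
  + by move=> /= n m; rewrite mulnS addnC.
  + apply: (@sat_alls T 2) => e'; apply/sat_iff; rewrite sat_ex /=.
    by split=> [lenm|[k <-]]; [exists (e' 0 - e' 1); rewrite subnK | exact: leq_addl].
- apply: sat_alls => e' /sat_inst H0 HS m.
  have HS1 k (Hk : sat T (push k e') B) : sat T (push k.+1 e') B.
    by apply: (sat_subst _ _ _).1 (HS k Hk) => -[].
  by elim: m.
- apply/sat_all => x; apply/sat_ex; exists (2 ^ x).
  have [a [b Hab]] := beta_exists (expn 2) x.+1.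
  apply/sat_ex; exists a; apply/sat_ex; exists b.
  apply/sat_and; split; first exact/sat_Beta/Hab.
  apply/sat_and; split; last first.
    by apply/sat_and; split=> //; apply/sat_Beta/Hab => /=.
  apply/sat_all => i; apply/sat_imp => ltix; apply/sat_ex; exists (2 ^ i).
  apply/sat_and; split; apply/sat_Beta => /=; first exact/Hab/ltnW.
  by rewrite addnn -mul2n -expnS; apply: Hab.
Qed.

(** * Numerals and unique readability of codes *)

Lemma eval_num e n : eval e (num n) = n.
Proof.
(* The recursive call has fuel [f] but argument [m./2], so the claim is made for every sufficient
   fuel. *)
suff H f m : m <= f -> eval e (num_rec f m) = m by apply: H.
elim: f m => [|f IHf] m /=; first by case: m.
case: eqP => [-> //|m0] lemf.
have half_le : m./2 <= f by lia.
by case: ifP => odm /=; rewrite IHf //; lia.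
Qed.

Lemma word_code_rcons w l : word_code (rcons w l) = word_code w * 13 + digit l.
Proof. by rewrite /word_code foldl_rcons. Qed.

(** Digits lie strictly between 0 and 13: the remainder gives the last letter, and no nonempty word
    has code 0. *)
Lemma word_code_inj : injective word_code.
Proof.
have digit_range l : 0 < digit l < 13 by case: l.
have digit_inj : injective digit by do 2!case.
elim/last_ind => [|w l IHw]; elim/last_ind => [|w' l' _] //.
- by rewrite word_code_rcons /word_code /=; have := digit_range l'; lia.
- by rewrite word_code_rcons /word_code /=; have := digit_range l; lia.
rewrite !word_code_rcons => eqc; have /andP[_ ll] := digit_range l.
have /andP[_ ll'] := digit_range l'.
have /IHw -> : word_code w = word_code w' by lia.
by have /digit_inj -> : digit l = digit l' by lia.
Qed.

(* A stack machine reading reverse Polish notation; ill-formed inputs leave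
   the stack unchanged. *)
Definition read (s : seq (tm + fm)) (l : letter) : seq (tm + fm) :=
  match l, s with
  | L_zero, _ => inl Zero :: s
  | L_var, _ => inl (Var 0) :: s
  | L_bar, inl (Var n) :: s' => inl (Var n.+1) :: s'
  | L_succ, inl t :: s' => inl (Succ t) :: s'
  | L_add, inl u :: inl t :: s' => inl (Add t u) :: s'
  | L_mul, inl u :: inl t :: s' => inl (Mul t u) :: s'
  | L_eq, inl u :: inl t :: s' => inr (Eq t u) :: s'
  | L_le, inl u :: inl t :: s' => inr (Le t u) :: s'
  | L_tr, inl t :: s' => inr (Tr t) :: s'
  | L_bot, _ => inr Bot :: s
  | L_imp, inr B :: inr A :: s' => inr (Imp A B) :: s'
  | L_all, inr A :: s' => inr (All A) :: s'
  | _, _ => s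
  end.

Lemma read_tm_word t s : foldl read s (tm_word t) = inl t :: s.
Proof.
elim: t s => [n|//|t IHt|t IHt u IHu|t IHt u IHu] s /=;
  rewrite ?foldl_cat ?IHt ?foldl_cat ?IHu //.
suff H m : foldl read (inl (Var m) :: s) (nseq n L_bar) = inl (Var (m + n)) :: s.
  by rewrite H.
by elim: n m => [|n IHn] m /=; rewrite ?addn0 // IHn addSnnS.
Qed.

Lemma read_fm_word A s : foldl read s (fm_word A) = inr A :: s.
Proof.
by elim: A s => [t u|t u|t||A IHA B IHB|A IHA] s /=;
  rewrite ?foldl_cat ?read_tm_word ?IHA ?foldl_cat ?read_tm_word ?IHB.
Qed.

Lemma code_inj : injective code.
Proof.
move=> A B /word_code_inj eqw.
by have := read_fm_word A [::]; rewrite eqw read_fm_word => -[].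
Qed.

(** * Coded models of finitely many axioms *)

Lemma finite_TB_model L : List.Forall (join EA TB) L ->
  exists a b, forall e, List.Forall (sat (fun c => beta a b c 1) e) L.
Proof.
(* The predicate [xpredT] and the zero valuation are arbitrary choices: the truth of an arithmetical
   sentence depends on neither. *)
pose truth c := exists A,
  [/\ arithmetical A, sentence A, code A = c & sat xpredT (fun=> 0) A].
(* Each axiom of [TB] tests [Tr] at a single code; the bound [n] is collected along [L] before
   [truth] is coded below it. *)
move=> HL; suff [n Hn] : exists n, forall T : nat -> Prop,
    (forall c, c < n -> (T c <-> truth c)) -> forall e, List.Forall (sat T e) L.
  have [a [b Hab]] := beta_pred truth n.
  by exists a, b; apply: Hn.
elim: HL => [|C L' HC _ [n Hn]]; first by exists 0 => T _ e; constructor.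
case: HC => [CEA|[A aA sA]].
  by exists n => T HT e; constructor; [apply: sat_EA | apply: Hn].
exists (maxn n (code A).+1) => T HT e; constructor; last first.
  by apply: Hn => c ltcn; apply: HT; rewrite leq_max ltcn.
apply/sat_iff; rewrite [sat _ _ (Tr _)]/= eval_num HT ?leq_max ?leqnn ?orbT //.
have -> : sat T e A <-> sat xpredT (fun=> 0) A.
  by rewrite (sat_arithmetical _ xpredT) // (sat_bounded _ (e' := fun=> 0) sA).
split=> [HA|[A' [_ _ /code_inj -> //]]].
by exists A.
Qed.

(** * Arithmetical reading of [Tr], and bookkeeping of free variables *)

Fixpoint beta_Tr (a b : tm) (A : fm) : fm :=
  match A with
  | Tr t => Beta a b t (Succ Zero)
  | Imp B C => Imp (beta_Tr a b B) (beta_Tr a b C)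
  | All B => All (beta_Tr (shift a) (shift b) B)
  | _ => A
  end.

Lemma sat_beta_Tr T e a b A :
  sat T e (beta_Tr a b A) <->
  sat (fun c => beta (eval e a) (eval e b) c 1) e A.
Proof.
elim: A e a b => [s t|s t|t||B IHB C IHC|B IHB] e a b //.
- exact: sat_Beta.
- by rewrite /= IHB IHC.
- by split=> /= H n; move: (H n); rewrite IHB !eval_shift.
Qed.

Lemma arithmetical_beta_Tr a b A : arithmetical (beta_Tr a b A).
Proof. by elim: A a b => //= B IHB C IHC a b; rewrite IHB IHC. Qed.

Lemma bounded_subst_tm n m f t :
  bounded_tm n t -> (forall i, i < n -> bounded_tm m (f i)) ->
  bounded_tm m (subst_tm f t).
Proof.
move=> bt bf; elim: t bt => //= s IHs u IHu;
by case/andP=> /IHs -> /IHu ->.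
Qed.

Lemma bounded_shift n t : bounded_tm n t -> bounded_tm n.+1 (shift t).
Proof. by move=> bt; apply: (bounded_subst_tm bt). Qed.

Lemma bounded_subst n m f A :
  bounded n A -> (forall i, i < n -> bounded_tm m (f i)) ->
  bounded m (subst f A).
Proof.
elim: A n m f => [s t|s t|t||B IHB C IHC|B IHB] n m f /= bA bf //.
- by case/andP: bA => bs bt; rewrite !(bounded_subst_tm _ bf).
- by case/andP: bA => bs bt; rewrite !(bounded_subst_tm _ bf).
- exact: bounded_subst_tm bf.
- by case/andP: bA => bB bC; rewrite (IHB n) ?(IHC n).
- by apply: (IHB n.+1) => // -[|i] //= /bf /bounded_shift.
Qed.

Lemma bounded_tm_leq n m t : n <= m -> bounded_tm n t -> bounded_tm m t.
Proof.
move=> le_nm; elim: t => //= [i /leq_trans|s IHs u IHu|s IHs u IHu]; first exact.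
  by case/andP=> /IHs -> /IHu ->.
by case/andP=> /IHs -> /IHu ->.
Qed.

Lemma bounded_leq n m A : n <= m -> bounded n A -> bounded m A.
Proof.
elim: A n m => [s t|s t|t||B IHB C IHC|B IHB] n m le_nm //=.
- by case/andP=> /(bounded_tm_leq le_nm) -> /(bounded_tm_leq le_nm) ->.
- by case/andP=> /(bounded_tm_leq le_nm) -> /(bounded_tm_leq le_nm) ->.
- exact: bounded_tm_leq.
- by case/andP=> /(IHB _ _ le_nm) -> /(IHC _ _ le_nm) ->.
- exact: IHB.
Qed.

Lemma bounded_alls m n A : bounded m (alls n A) = bounded (n + m) A.
Proof. by elim: n m => //= n IHn m; rewrite IHn addnS. Qed.

Lemma bounded_exs m n A : bounded m (exs n A) = bounded (n + m) A.
Proof. by elim: n m => //= n IHn m; rewrite !andbT IHn addnS. Qed.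

Lemma arithmetical_exs n A : arithmetical (exs n A) = arithmetical A.
Proof. by elim: n => //= n ->; rewrite !andbT. Qed.

Lemma bounded_Not n A : bounded n (Not A) = bounded n A.
Proof. exact: andbT. Qed.

Lemma arithmetical_Not A : arithmetical (Not A) = arithmetical A.
Proof. exact: andbT. Qed.

Lemma bounded_And n A B : bounded n (And A B) = bounded n A && bounded n B.
Proof. by rewrite /= !andbT. Qed.

Lemma bounded_Iff n A B : bounded n (Iff A B) = bounded n A && bounded n B.
Proof. by rewrite bounded_And /= [_ B && _]andbC andbb. Qed.

Lemma arithmetical_And A B :
  arithmetical (And A B) = arithmetical A && arithmetical B.
Proof. by rewrite /= !andbT. Qed.

Lemma bounded_beta_Tr n a b A :
  bounded_tm n a -> bounded_tm n b -> bounded n A -> bounded n (beta_Tr a b A).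
Proof.
elim: A n a b => [s t|s t|t||B IHB C IHC|B IHB] n a b ba bb //=.
- by move=> bt; rewrite bb bt !bounded_shift.
- by case/andP=> bB bC; rewrite IHB ?IHC.
- by move=> bB; rewrite IHB ?bounded_shift.
Qed.

(** * Words with holes *)

Lemma tm_template_bounded k t :
  bounded_tm k t -> tm_template k t = letters (tm_word t).
Proof.
rewrite /letters.
elim: t => //= [n ->//|t IHt /IHt ->|t IHt u IHu|t IHt u IHu].
- by rewrite map_cat.
- by case/andP=> /IHt -> /IHu ->; rewrite !map_cat.
- by case/andP=> /IHt -> /IHu ->; rewrite !map_cat.
Qed.

Lemma fm_template_bounded k A :
  bounded k A -> fm_template k A = letters (fm_word A).
Proof.
rewrite /letters; elim: A k => //= [s t|s t|t|B IHB C IHC|B IHB] k.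
- by case/andP=> /tm_template_bounded -> /tm_template_bounded ->; rewrite !map_cat.
- by case/andP=> /tm_template_bounded -> /tm_template_bounded ->; rewrite !map_cat.
- by move=> /tm_template_bounded ->; rewrite !map_cat.
- by case/andP=> /IHB -> /IHC ->; rewrite !map_cat.
- by move=> /IHB ->; rewrite !map_cat.
Qed.

(** The suffix matters only through two numbers, which lets the liar formula receive its own suffix
    as arguments. *)
Lemma eval_template_cat e y p v w :
  eval e (template_tm y p (v ++ letters w)) =
  eval e (template_tm y p v) * 13 ^ size w + word_code w.
Proof.
rewrite /letters; elim/last_ind: w => [|w l IHw].
  by rewrite cats0 muln1 addn0.
rewrite map_rcons -rcons_cat word_code_rcons size_rcons.
rewrite {1}/template_tm foldl_rcons -/(template_tm y p _) [LHS]/= !eval_num IHw.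
by rewrite expnS; lia.
Qed.

Lemma bounded_template_cat n y p v w :
  bounded_tm n (template_tm y p v) ->
  bounded_tm n (template_tm y p (v ++ letters w)).
Proof.
rewrite /letters => bv; elim/last_ind: w => [|w l IHw]; first by rewrite cats0.
rewrite map_rcons -rcons_cat {1}/template_tm foldl_rcons -/(template_tm y p _).
by rewrite /= IHw; case: l.
Qed.

(** * The translation as a change of the reading of [Tr] *)

Definition truth_value (T : nat -> Prop) (tau : fm) (c : nat) : Prop :=
  sat T (fun=> c) tau.

Lemma sat_inst_truth T e tau t : bounded 1 tau ->
  sat T e (inst tau t) <-> truth_value T tau (eval e t).
Proof. by move=> btau; rewrite sat_inst; apply: sat_bounded btau _ => -[]. Qed.

Lemma sat_translate T e tau A : bounded 1 tau ->
  sat T e (translate tau A) <-> sat (truth_value T tau) e A.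
Proof.
move=> btau; elim: A e => [s t|s t|t||B IHB C IHC|B IHB] e //.
- exact: sat_inst_truth.
- by rewrite /= IHB IHC.
- by split=> /= H n; apply/IHB.
Qed.

(** Only extensions [e'] of [e] are considered, so the equivalence may rely on the values of the
    parameters. *)
Lemma eq_sat_exs n T e A B :
  (forall e', (forall i, e' (n + i) = e i) -> sat T e' A <-> sat T e' B) ->
  sat T e (exs n A) <-> sat T e (exs n B).
Proof.
elim: n e => [|n IHn] e eqAB; first exact: eqAB.
rewrite [exs n.+1 A]/= [exs n.+1 B]/= !sat_ex.
have IH k : sat T (push k e) (exs n A) <-> sat T (push k e) (exs n B).
  by apply: IHn => e' ee'; apply: eqAB => i; rewrite addSnnS ee'.
by split=> -[k /IH]; exists k.
Qed.

(** * The liar formula *)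

Definition dotted (B : fm) : fm :=
  exs 8 (And (ands [seq And (Num (Var (8 + i)) (Var i))
                            (Len (Var i) (Var (4 + i))) | i <- iota 0 4]) B).

Definition holes_tm : seq token -> tm :=
  template_tm Var (fun i => Var (4 + i)).

Lemma Tr_dotE A : Tr_dot 4 A = dotted (Tr (holes_tm (fm_template 0 A))).
Proof. by []. Qed.

(* Equivalent to [B], but its free variables occur once each, in front of [B]:
   all holes of its template are in [copy_prefix], and the rest of the template
   is described by two numbers, which the formula can receive as arguments. *)
Definition copy (B : fm) : fm :=
  alls 4 (foldr Imp B [seq Eq (Var i) (Var (4 + i)) | i <- iota 0 4]).

Definition copy_prefix : seq token :=
  flatten [seq fm_template 4 (Eq (Var i) (Var (4 + i))) | i <- iota 0 4].

Definition copy_suffix (B : fm) : seq letter :=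
  fm_word B ++ nseq 4 L_imp ++ nseq 4 L_all.

(** Reverse Polish notation puts connectives last, so the four equations open the word; behind them,
    the quantifiers of [copy] bind every free variable of [B] and leave no hole. *)
Lemma copy_template B : bounded 4 B ->
  fm_template 0 (copy B) = copy_prefix ++ letters (copy_suffix B).
Proof.
by move=> bB; rewrite /= (fm_template_bounded bB) /letters !map_cat -!catA.
Qed.

Lemma arithmetical_copy B : arithmetical (copy B) = arithmetical B.
Proof. by []. Qed.

Lemma sat_copy T e B : bounded 4 B -> sat T e (copy B) <-> sat T e B.
Proof.
move=> bB; split=> [H|HB].
  have {H}: sat T (push (e 0) (push (e 1) (push (e 2) (push (e 3) e)))) B.
    (* The outermost quantifier binds [Var 3]. *)
    exact: (H (e 3) (e 2) (e 1) (e 0) erefl erefl erefl erefl).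
  by apply: (sat_bounded _ bB _).1 => -[|[|[|[|]]]].
move=> /= k3 k2 k1 k0 e0 e1 e2 e3.
suff : sat T (push k0 (push k1 (push k2 (push k3 e)))) B by [].
by apply: (sat_bounded _ bB _).1 HB => -[|[|[|[|]]]].
Qed.

(* The arguments [Var 0], [Var 1] code [Tr]; [Var 2], [Var 3] are meant to be
   [13 ^ size w] and [word_code w] for [w] the suffix of [copy (liar tau)].
   Under the eight quantifiers of [dotted] their indices increase by 8. *)
Definition liar (tau : fm) : fm :=
  Not (dotted (beta_Tr (Var 8) (Var 9)
    (inst tau (Add (Mul (holes_tm copy_prefix) (Var 10)) (Var 11))))).

Lemma bounded_liar tau : bounded 1 tau -> bounded 4 (liar tau).
Proof.
move=> btau; rewrite /liar bounded_Not /dotted bounded_exs bounded_And.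
apply/andP; split; first by vm_compute.
apply: bounded_beta_Tr => //; by apply: bounded_subst btau _ => -[].
Qed.

Lemma arithmetical_liar tau : arithmetical (liar tau).
Proof.
rewrite /liar arithmetical_Not /dotted arithmetical_exs.
by rewrite arithmetical_And arithmetical_beta_Tr andbT.
Qed.

Lemma bounded_UTB_ax B : bounded 4 B ->
  bounded 4 (copy B) /\ bounded 4 (Tr_dot 4 (copy B)).
Proof.
move=> bB; split.
  by rewrite bounded_alls /= (bounded_leq _ bB).
rewrite Tr_dotE (copy_template bB) bounded_exs bounded_And.
apply/andP; split; first by vm_compute.
exact: bounded_template_cat.
Qed.

Theorem theorem5p9 : ~ id_interprets TB UTB.
Proof.
case=> tau [btau interp].
set B := liar tau; have bB : bounded 4 B := bounded_liar btau.
have [bA bTrA] := bounded_UTB_ax bB.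
have aA : arithmetical (copy B).
  by rewrite arithmetical_copy arithmetical_liar.
set U := alls 4 (Iff (Tr_dot 4 (copy B)) (copy B)).
have sU : sentence U.
  by rewrite /sentence bounded_alls bounded_Iff bA bTrA.
have /(interp _ sU)/nd_sound[L /finite_TB_model[a [b HL]] LU] :
    provable (join EA UTB) U.
  by apply: nd_ctx; right; apply: UTB_ax.
pose T c := beta a b c 1; pose P := truth_value T tau.
pose w := copy_suffix B.
(* Self-reference: [liar tau] is built from [copy_prefix] alone, and the rest of the word of
   [copy B] reaches it as two arguments. *)
pose e := push a (push b (push (13 ^ size w) (push (word_code w) (fun=> 0)))).
have alls4 X : sat P (fun=> 0) (alls 4 X) -> sat P e X.
  by move=> HX; apply: HX.
have := LU T (fun=> 0) (HL _); rewrite (sat_translate _ _ _ btau) => /alls4.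
rewrite sat_iff (sat_copy _ _ bB).
set D := dotted (beta_Tr (Var 8) (Var 9)
  (inst tau (Add (Mul (holes_tm copy_prefix) (Var 10)) (Var 11)))).
have : sat P e B <-> ~ sat P e D := sat_not P e D.
(* Disquotation makes [Tr_dot 4 (copy B)] equivalent to [B], the negation of [D]; equivalence with
   [D] is then absurd. *)
suff : sat P e (Tr_dot 4 (copy B)) <-> sat P e D by tauto.
rewrite Tr_dotE (copy_template bB); apply: eq_sat_exs => e' e'e.
rewrite !sat_and sat_beta_Tr (sat_inst_truth _ _ _ btau).
have [e8 e9 e10 e11] : [/\ eval e' (Var 8) = a, eval e' (Var 9) = b,
    eval e' (Var 10) = 13 ^ size w & eval e' (Var 11) = word_code w].
  by split; [apply: (e'e 0)|apply: (e'e 1)|apply: (e'e 2)|apply: (e'e 3)].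
(* Whatever the witnesses, [tau] is applied to the same number on both sides. *)
have <- : eval e' (holes_tm (copy_prefix ++ letters w)) =
    eval e' (Add (Mul (holes_tm copy_prefix) (Var 10)) (Var 11)).
  by rewrite eval_template_cat -e10 -e11.
by rewrite e8 e9; apply: iff_refl.
Qed.
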